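(* Let $a>1$ be any real number, and let $P^a$ be the group of all orientation preserving piecewise linear homeomorphisms of $[0,1]$ all of whose slopes lie in $a^{\mathbb Z}=\{a^k\mid k\in\mathbb Z\}$. Then $P^a$ is invariably generated.
   Context: Piecewise linear homeomorphisms of $[0,1]$ have finitely many breaks, a break being a point of $(0,1)$ at which the map is not differentiable (no restriction is placed on the location of breaks for elements of $P^a$); the group operation is composition. A subgroup $H$ of a group $G$ is called classful if for every $g\in G$ some conjugate of $g$ in $G$ lies in $H$, equivalently $\bigcup_{g\in G} gHg^{-1}=G$. A group $G$ is invariably generated if it has no classful subgroup other than $G$ itself. *)

(* Defs.v *)
From HB Require Import structures.
From mathcomp Require Import all_boot all_order all_algebra.
From mathcomp Require Import all_classical all_reals all_analysis.

Set Implicit Arguments.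
Unset Strict Implicit.
Unset Printing Implicit Defensive.
Import Order.TTheory GRing.Theory Num.Theory.
Import numFieldNormedType.Exports.

Local Open Scope classical_set_scope.
Local Open Scope ring_scope.

Definition conjugate (G : groupType) (g h : G) : Prop :=
  exists k : G, h = (g ^ k)%g.

Definition classful (G : groupType) (H : set G) : Prop :=
  forall g : G, exists2 h : G, conjugate g h & H h.

Definition invariably_generated (G : groupType) : Prop :=
  forall H : set G, group_closed [in H] -> classful H -> H = [set: G].

(* A point of [0, 1] is a real number bundled with a proof of membership; the
   topology is the one [set_type] inherits from R. *)
Notation unit_interval R := (set_type (`[0%R, 1%R]%classic : set R)).

Section PiecewiseLinear.
Variable R : realType.
Implicit Types (f g : unit_interval R -> unit_interval R).
Implicit Types (x y z t : unit_interval R) (c a : R).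

Definition homeomorphism f : Prop :=
  exists g, [/\ cancel f g, cancel g f, continuous f & continuous g].

Definition orientation_preserving f : Prop :=
  {homo f : x y / \val x < \val y}.

Definition affine_on f x y c : Prop :=
  forall t, \val x <= \val t <= \val y ->
    \val (f t) = \val (f x) + c * (\val t - \val x).

(* The finite list [s] contains all the breaks of [f], and possibly other
   points. *)
Definition piecewise_linear f : Prop :=
  exists s : seq (unit_interval R), forall x y, \val x < \val y ->
    (forall z, z \in s -> ~~ (\val x < \val z < \val y)) ->
    exists c, affine_on f x y c.

(* For a piecewise linear [f], these are the values of the derivative of [f]
   at the points of (0, 1) that are not breaks. *)
Definition is_slope f c : Prop :=
  exists x y, \val x < \val y /\ affine_on f x y c.

Record Pa_map a f : Prop := {
  Pa_homeo : homeomorphism f;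
  Pa_mono : orientation_preserving f;
  Pa_pl : piecewise_linear f;
  Pa_slope : forall c, is_slope f c -> exists k : int, c = a ^ k }.

Lemma orientation_preserving_le f : orientation_preserving f ->
  {mono f : x y / \val x <= \val y}.
Proof.
move=> fm x y; have [xy|yx|/val_inj ->] := ltgtP (\val x) (\val y).
- by rewrite ltW// fm.
- by apply/negbTE; rewrite -ltNge fm.
- by rewrite lexx.
Qed.

Lemma orientation_preserving_lt f : orientation_preserving f ->
  {mono f : x y / \val x < \val y}.
Proof. by move=> fm x y; rewrite !ltNge orientation_preserving_le. Qed.

Lemma orientation_preserving_inv f g : cancel g f ->
  orientation_preserving f -> orientation_preserving g.
Proof. by move=> gK fm x y xy; rewrite -(orientation_preserving_lt fm) !gK. Qed.

Lemma affine_on_neq0 f x y c : orientation_preserving f ->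
  \val x < \val y -> affine_on f x y c -> c != 0.
Proof.
move=> fm xy fc; apply/eqP => c0; have := fm _ _ xy.
by rewrite (fc y) ?lexx ?ltW// c0 mul0r addr0 ltxx.
Qed.

Lemma affine_on_sub f x y x' y' c :
  \val x <= \val x' -> \val x' <= \val y' -> \val y' <= \val y ->
  affine_on f x y c -> affine_on f x' y' c.
Proof.
move=> xx x'y' yy fc t /andP[xt ty].
rewrite (fc t) ?(le_trans xx xt) ?(le_trans ty)// (fc x') ?xx ?(le_trans x'y')//.
by rewrite -addrA -mulrDr; congr (_ + _ * _); rewrite [RHS]addrC subrKA.
Qed.

Lemma affine_on_uniq f x y c d : \val x < \val y ->
  affine_on f x y c -> affine_on f x y d -> c = d.
Proof.
move=> xy fc fd.
have := fc y; rewrite (fd y) ?lexx ?ltW// => /(_ isT)/addrI/mulIf -> //.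
by rewrite subr_eq0 gt_eqF.
Qed.

Lemma affine_on_comp f g x y c d : orientation_preserving g ->
  affine_on g x y c -> affine_on f (g x) (g y) d ->
  affine_on (f \o g) x y (d * c).
Proof.
move=> gm gc fd t xty; rewrite /= fd ?orientation_preserving_le// (gc t)//.
by rewrite [X in d * X]addrC addKr mulrA.
Qed.

Lemma affine_on_inv f g x y c : cancel f g -> cancel g f ->
  orientation_preserving f -> \val x < \val y ->
  affine_on f (g x) (g y) c -> affine_on g x y c^-1.
Proof.
move=> fK gK fm xy fc t xty.
have gm := orientation_preserving_inv gK fm.
have c0 : c != 0 by apply: (affine_on_neq0 fm _ fc); exact: gm.
have := fc (g t); rewrite !gK !orientation_preserving_le// => /(_ xty) ->.
by rewrite [X in c^-1 * X]addrC addKr mulKf// addrC subrK.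
Qed.

(* A piecewise linear map is affine on a smaller nondegenerate interval. *)
Lemma piecewise_linear_refine f x y : piecewise_linear f -> \val x < \val y ->
  exists y', [/\ \val x < \val y', \val y' <= \val y &
    exists c, affine_on f x y' c].
Proof.
move=> [s fs] xy.
suff [y' [xy' y'y sy']] : exists y', [/\ \val x < \val y', \val y' <= \val y &
    forall z, z \in s -> ~~ (\val x < \val z < \val y')].
  by exists y'; split => //; exact: fs.
elim: s {fs} => [|z s [y' [xy' y'y sy']]]; first by exists y; rewrite lexx.
have [/andP[xz zy']|nz] := boolP (\val x < \val z < \val y').
  exists z; split => //; first exact/ltW/(lt_le_trans zy').
  move=> w; rewrite in_cons => /predU1P[->|/sy']; first by rewrite ltxx andbF.
  by apply: contra => /andP[-> wz]; exact: lt_trans zy'.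
by exists y'; split => // w; rewrite in_cons => /predU1P[->//|]; exact: sy'.
Qed.

Lemma expfz_mul_ex a (k l : int) : a ^ k != 0 -> a ^ l != 0 ->
  exists m : int, a ^ k * a ^ l = a ^ m.
Proof.
have [->|a0] := eqVneq a 0; last by exists (k + l); rewrite expfzDr.
rewrite !exp0rz; case: (k == 0); case: (l == 0); rewrite ?eqxx// => _ _.
by exists 0; rewrite expr0z mulr1.
Qed.

Lemma Pa_map_id a : Pa_map a id.
Proof.
split.
- by exists id; split => // x; exact: cvg_id.
- by [].
- by exists [::] => x y _ _; exists 1 => t _; rewrite mul1r addrC subrK.
- move=> c [x [y [xy fc]]]; exists 0; rewrite expr0z.
  by apply: (affine_on_uniq xy fc) => t _; rewrite mul1r addrC subrK.
Qed.

Lemma Pa_map_comp a f g : Pa_map a f -> Pa_map a g -> Pa_map a (f \o g).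
Proof.
move=> [[f' [fK f'K fc f'c]] fm fpl fsl] [[g' [gK g'K gc g'c]] gm gpl gsl].
split.
- exists (g' \o f'); split; [exact: can_comp|exact: can_comp| |].
  + by move=> x; apply: continuous_comp; [exact: gc|exact: fc].
  + by move=> x; apply: continuous_comp; [exact: f'c|exact: g'c].
- by move=> x y /gm/fm.
- move: fpl gpl => [s fs] [r gr].
  exists (r ++ map g' s) => x y xy xysr.
  have [z zr|c gxy] := gr x y xy; first by apply: xysr; rewrite mem_cat zr.
  have [||d fxy] := fs (g x) (g y); first exact: gm.
    move=> z zs; rewrite -[z]g'K !orientation_preserving_lt//.
    by apply: xysr; rewrite mem_cat map_f ?orbT.
  by exists (d * c); exact: affine_on_comp.
- move=> e [x [y [xy fge]]].
  have [y1 [xy1 y1y [c gxy]]] := piecewise_linear_refine gpl xy.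
  have [w [xw wy1 [d fxw]]] := piecewise_linear_refine fpl (gm _ _ xy1).
  rewrite -[w]g'K in xw wy1 fxw.
  rewrite orientation_preserving_lt// in xw.
  rewrite orientation_preserving_le// in wy1.
  have {}gxy : affine_on g x (g' w) c.
    exact: (affine_on_sub (lexx _) (ltW xw) wy1 gxy).
  have -> : e = d * c.
    apply: (affine_on_uniq xw _ (affine_on_comp gm gxy fxw)).
    exact: (affine_on_sub (lexx _) (ltW xw) (le_trans wy1 y1y) fge).
  have [k dk] : exists k : int, d = a ^ k.
    by apply: fsl; exists (g x), (g (g' w)); split => //; exact: gm.
  have [l cl] : exists l : int, c = a ^ l.
    by apply: gsl; exists x, (g' w).
  rewrite dk cl; apply: expfz_mul_ex.
    by rewrite -dk; apply: affine_on_neq0 fxw => //; exact: gm.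
  by rewrite -cl; exact: affine_on_neq0 gxy.
Qed.

Lemma Pa_map_inv a f g : cancel f g -> cancel g f -> Pa_map a f -> Pa_map a g.
Proof.
move=> fK gK [[f' [fK' f'K fc f'c]] fm fpl fsl].
have f'E : f' = g by apply/funext => x; apply: (can_inj fK'); rewrite f'K gK.
rewrite {}f'E in f'c; have gm := orientation_preserving_inv gK fm.
split => //.
- by exists f.
- move: fpl => [s fs]; exists (map f s) => x y xy xys.
  have [||c fxy] := fs (g x) (g y); first exact: gm.
    move=> z zs; rewrite -[z]fK !orientation_preserving_lt//.
    by apply: xys; rewrite map_f.
  by exists c^-1; exact: affine_on_inv fxy.
- move=> c [x [y [xy gxy]]].
  have cf : affine_on f (g x) (g y) c^-1.
    apply: (affine_on_inv gK fK gm); first exact: gm.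
    by rewrite !gK.
  have [|k ck] := fsl c^-1; first by exists (g x), (g y); split => //; exact: gm.
  by exists (- k); rewrite -invr_expz -ck invrK.
Qed.

End PiecewiseLinear.

Record Pa (R : realType) (a : R) := MkPa {
  Pa_fun :> unit_interval R -> unit_interval R;
  Pa_funP : Pa_map a Pa_fun }.

HB.instance Definition _ (R : realType) (a : R) := gen_eqMixin (Pa a).
HB.instance Definition _ (R : realType) (a : R) := gen_choiceMixin (Pa a).

Section PaGroup.
Variables (R : realType) (a : R).
Implicit Types f g h : Pa a.

Lemma Pa_eq f g : f =1 g -> f = g.
Proof.
case: f g => [f fP] [g gP] /= /funext fg; case: _ / fg gP => gP.
by congr MkPa; exact: Prop_irrelevance.
Qed.

Definition Pa_one : Pa a := MkPa (Pa_map_id a).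

Definition Pa_mul f g : Pa a := MkPa (Pa_map_comp (Pa_funP f) (Pa_funP g)).

Lemma Pa_inv_subproof f :
  {g : unit_interval R -> unit_interval R | cancel f g /\ cancel g f}.
Proof. by apply: cid; have [g []] := Pa_homeo (Pa_funP f); exists g. Qed.

Definition Pa_inv f : Pa a :=
  let: exist g (conj fK gK) := Pa_inv_subproof f in
  MkPa (Pa_map_inv fK gK (Pa_funP f)).

Let mulA : associative Pa_mul. Proof. by move=> f g h; exact: Pa_eq. Qed.
Let mul1 : left_id Pa_one Pa_mul. Proof. by move=> f; exact: Pa_eq. Qed.
Let mulr1 : right_id Pa_one Pa_mul. Proof. by move=> f; exact: Pa_eq. Qed.
Let mulV : left_inverse Pa_one Pa_inv Pa_mul.
Proof.
move=> f; apply: Pa_eq => x /=; rewrite /Pa_inv.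
by case: Pa_inv_subproof => g [fK gK] /=; exact: fK.
Qed.
Let mulrV : right_inverse Pa_one Pa_inv Pa_mul.
Proof.
move=> f; apply: Pa_eq => x /=; rewrite /Pa_inv.
by case: Pa_inv_subproof => g [fK gK] /=; exact: gK.
Qed.

HB.instance Definition _ :=
  isGroup.Build (Pa a) mulA mul1 mulr1 mulV mulrV.

Lemma Pa_mulE f g (x : unit_interval R) : (f * g)%g x = f (g x).
Proof. by []. Qed.

End PaGroup.

(* Main.v *)
Require Import Defs.
From mathcomp Require Import all_boot all_order all_algebra.
From mathcomp Require Import all_classical all_reals all_analysis.
From mathcomp Require Import ring lra.
Import Order.TTheory GRing.Theory Num.Theory.
Import numFieldNormedType.Exports.
Local Open Scope ring_scope.

Set Implicit Arguments.
Unset Strict Implicit.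
Unset Printing Implicit Defensive.

(* Let H be a classful subgroup of P^a.

   H is transitive on (0, 1).  Call g a bump on (0, 1) if g t > t there, with
   slope a at 0 and 1/a at 1.  The two germs of a bump are invariant under
   conjugation, because germs at an end point commute.  Fix a bump h in H; its
   powers bring any x, y in (0, 1) to points c near 0 and v near 1.
   Some bump g sends c to v, and a conjugate of g lies in H.  The conjugator
   multiplies c / a^n and (1 - v) / a^n by powers of a for large n, an effect
   that powers of h undo, so x and y are in the same H-orbit.

   H agrees with any k in P^a near any point x.  Conjugates of bumps on (0, x)
   and (x, 1) lie in H; their powers realize all pairs (a^i, a^j) of one-sided
   slopes at the fixed point x.

   H agrees with any k in P^a on any [u, v] inside (0, 1).  Local matches are
   glued at y: if d in H is the identity on [w, y] and f in H is a bump on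
   (0, y), then f^-n d f^n is the identity on [u, y] for n large and equals d
   beyond y.

   Hence H contains every g with compact support in (0, 1): H contains some g^k
   and some h equal to k on the support of g^k, and g is then conjugate to g^k
   by h.  For arbitrary g, with g^k in H, the element g (g^k)^-1 has compact
   support. *)

(** * Piecewise linear real functions *)

Section RealPiecewiseLinear.
Variables (R : realType) (a : R).
Hypothesis a_gt1 : 1 < a.
Implicit Types (F E : R -> R) (x y z t : R) (k : int).

Let a_gt0 : 0 < a. Proof. exact: lt_trans a_gt1. Qed.

Lemma expz_gt0 k : 0 < a ^ k.
Proof. exact: exprz_gt0. Qed.

Lemma exists_expn_gt (M : R) : exists n : nat, M < a ^+ n.
Proof.
have bernoulli n : 1 + n%:R * (a - 1) <= a ^+ n.
  elim: n => [|n IH]; first by rewrite mul0r addr0 expr0.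
  have n0 : 0 <= n%:R :> R by [].
  rewrite exprS -natr1.
  have := ler_wpM2l (ltW a_gt0) IH; apply: le_trans.
  rewrite -subr_ge0.
  have -> : a * (1 + n%:R * (a - 1)) - (1 + (n%:R + 1) * (a - 1)) =
            n%:R * (a - 1) ^+ 2 by ring.
  by rewrite mulr_ge0// sqr_ge0.
have a10 : 0 < a - 1 by rewrite subr_gt0.
exists (Num.bound (`|M| / (a - 1))).
apply: lt_le_trans (bernoulli _).
have := archi_boundP (divr_ge0 (normr_ge0 M) (ltW a10)).
rewrite ltr_pdivrMr// => h.
by apply: le_lt_trans (ler_norm M) _; apply: lt_trans h _; rewrite ltrDr.
Qed.

Definition affine F x y k := forall t, x <= t <= y -> F t = F x + a ^ k * (t - x).

(** Adjacent pieces share an end point, so continuity is built in, and facts about such functions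
    follow by induction on the pieces. *)
Inductive pl F : R -> R -> Prop :=
| pl_affine x y k : x <= y -> affine F x y k -> pl F x y
| pl_cat x y z : pl F x y -> pl F y z -> pl F x z.

Lemma pl_le F x y : pl F x y -> x <= y.
Proof. by elim=> // u v w _ uv _; exact: le_trans. Qed.

Lemma pl_homo F x y : pl F x y ->
  forall s t, x <= s -> s < t -> t <= y -> F s < F t.
Proof.
elim=> {x y} [x y k xy Fk|x y z xy IH1 yz IH2] s t xs st ty.
  rewrite (Fk s) ?(Fk t) ?xs ?ty ?(le_trans xs (ltW st)) ?(le_trans (ltW st) ty)//.
  by rewrite ltrD2l ltr_pM2l ?expz_gt0// ltrD2r.
have [tley|ylt] := leP t y; first exact: IH1.
have [ylts|sley] := leP y s; first exact: IH2.
by apply: (@lt_trans _ _ (F y)); [apply: IH1|apply: IH2]; rewrite // ltW.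
Qed.

Lemma pl_surj F x y : pl F x y ->
  forall w, F x <= w <= F y -> exists2 s, x <= s <= y & F s = w.
Proof.
elim=> {x y} [x y k xy Fk|x y z xy IH1 yz IH2] w /andP[xw wy].
  have k0 := expz_gt0 k.
  have sE : x <= x + (w - F x) / a ^ k <= y.
    rewrite lerDl divr_ge0 ?(ltW k0) ?subr_ge0// -lerBrDl ler_pdivrMr//.
    by move: wy; rewrite (Fk y) ?lexx ?xy// => wy; rewrite lerBlDl mulrC.
  exists (x + (w - F x) / a ^ k) => //.
  by rewrite Fk// [X in a ^ k * X]addrC addKr mulrC divfK ?gt_eqF// addrC subrK.
have xy' := pl_le xy; have yz' := pl_le yz.
have [wF|Fw] := leP w (F y).
  have [|s /andP[xs sy] <-] := IH1 w; first by rewrite xw.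
  by exists s; rewrite // xs (le_trans sy).
have [|s /andP[ys sz] <-] := IH2 w; first by rewrite (ltW Fw).
by exists s; rewrite // sz (le_trans xy').
Qed.

Lemma pl_breaks F x y : pl F x y -> exists s : seq R, forall x' y',
  x <= x' -> x' < y' -> y' <= y ->
  (forall z, z \in s -> ~~ (x' < z < y')) -> exists k, affine F x' y' k.
Proof.
elim=> {x y} [x y k xy Fk|x y z xy [s1 IH1] yz [s2 IH2]].
  exists [::] => x' y' xx' xy' yy' _; exists k => t /andP[x't ty'].
  rewrite (Fk t) ?(Fk x') ?xx' ?(le_trans xx' x't) ?(le_trans ty' yy')//; first by ring.
  exact: le_trans (ltW xy') yy'.
exists (y :: s1 ++ s2) => x' y' xx' xy' yz' ns.
have := ns y; rewrite mem_head => /(_ isT); rewrite negb_and -!leNgt.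
case/orP=> h; [apply: IH2|apply: IH1] => // w ws; apply: ns;
  by rewrite inE mem_cat ws ?orbT.
Qed.

Lemma pl_ext F E x y : (forall t, x <= t <= y -> F t = E t) -> pl F x y -> pl E x y.
Proof.
move=> FE Fpl; elim: Fpl FE => {x y} [x y k xy Fk|x y z xy IH1 yz IH2] FE.
  apply: (@pl_affine _ _ _ k) => // t xty.
  by rewrite -!FE ?lexx ?xy// Fk.
have xy' := pl_le xy; have yz' := pl_le yz.
apply: (@pl_cat _ _ y).
  by apply: IH1 => t /andP[xt ty]; apply: FE; rewrite xt (le_trans ty).
by apply: IH2 => t /andP[yt tz]; apply: FE; rewrite tz (le_trans xy').
Qed.

Lemma pl_glue F E x y z : pl F x y -> pl E y z -> F y = E y ->
  exists G, [/\ pl G x z, forall t, t <= y -> G t = F t &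
                forall t, y <= t -> G t = E t].
Proof.
move=> Fxy Eyz FE; pose G t := if t <= y then F t else E t.
have GF t : t <= y -> G t = F t by rewrite /G => ->.
have GE t : y <= t -> G t = E t.
  by rewrite /G le_eqVlt => /predU1P[<-|]; rewrite ?lexx// ltNge => /negbTE ->.
exists G; split => //; apply: (@pl_cat _ _ y).
  by apply: pl_ext Fxy => t /andP[_ /GF].
by apply: pl_ext Eyz => t /andP[/GE].
Qed.

Lemma pl_affine_fun x y (c x0 : R) k : x <= y -> pl (fun t => c + a ^ k * (t - x0)) x y.
Proof. by move=> xy; apply: (@pl_affine _ _ _ k) => // t _; ring. Qed.

Lemma pl_id x y : x <= y -> pl id x y.
Proof. by move=> xy; apply: (@pl_affine _ _ _ 0) => // t _; rewrite expr0z; ring. Qed.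

(** One affine piece would need slope [l' / l], which may not be a power of [a]. Two pieces of
    slopes [c] = a^n and 1/c suffice once [l' / l] lies between them; the length [p] of the first
    solves c p + (l - p) / c = l'. *)
Lemma pl_interpolation x y x' y' : x < y -> x' < y' ->
  exists F, [/\ pl F x y, F x = x' & F y = y'].
Proof.
move=> xy x'y'; pose l := y - x; pose l' := y' - x'.
have l0 : 0 < l by rewrite subr_gt0.
have l'0 : 0 < l' by rewrite subr_gt0.
have [n] := exists_expn_gt (1 + l' / l + l / l').
set c := a ^+ n => cn.
have r0 : 0 < l' / l by rewrite divr_gt0.
have r'0 : 0 < l / l' by rewrite divr_gt0.
have c1 : 1 < c by lra.
have c0 : 0 < c by lra.
have l'c : l' < c * l by rewrite -ltr_pdivrMr//; lra.
have lc : l < c * l' by rewrite -ltr_pdivrMr//; lra.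
have Vc1 : c^-1 < 1 by rewrite invf_lt1.
have cc0 : 0 < c - c^-1 by lra.
have lc' : c^-1 * l < l' by rewrite ltr_pdivrMl.
pose p := (l' - c^-1 * l) / (c - c^-1).
have p0 : 0 <= p by apply: divr_ge0; [rewrite subr_ge0|]; exact: ltW.
have p_le_l : p <= l.
  by rewrite ler_pdivrMr//; lra.
have pE : p * (c - c^-1) = l' - c^-1 * l by rewrite divfK ?gt_eqF.
have cE : a ^ (n : int) = c by [].
have VcE : a ^ (- (n : int)) = c^-1 by rewrite -invr_expz.
have pl1 : pl (fun t => x' + a ^ (n : int) * (t - x)) x (x + p).
  by apply: pl_affine_fun; rewrite lerDl.
have pl2 : pl (fun t => x' + c * p + a ^ (- (n : int)) * (t - (x + p))) (x + p) y.
  by apply: pl_affine_fun; rewrite -lerBrDl.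
have [|F [Fpl F1 F2]] := pl_glue pl1 pl2.
  by rewrite cE VcE; ring.
exists F; split => //; first by rewrite F1 ?lerDl// cE; ring.
rewrite F2 -?lerBrDl// VcE.
have -> : y = l + x by rewrite subrK.
have -> : x' + c * p + c^-1 * (l + x - (x + p)) =
          x' + p * (c - c^-1) + c^-1 * l by ring.
by rewrite pE /l'; ring.
Qed.

(* The graph is forced on [p, p + (u - p) / a] and [v, q]; two interpolations
   through (u, v) fill the gap, and stay above the diagonal by monotonicity. *)
Lemma pl_bump p q u v : p < u -> u < v -> v < q ->
  exists F, [/\ pl F p q,
    forall t, p <= t -> t <= p + (u - p) / a -> F t = p + a * (t - p),
    F u = v, forall t, v <= t -> t <= q -> F t = q - (q - t) / a &
    forall t, p < t < q -> t < F t].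
Proof.
move=> pu uv vq.
have a1V : a^-1 < 1 by rewrite invf_lt1.
have aV0 : 0 < a^-1 by rewrite invr_gt0.
pose p' := p + (u - p) / a; pose q' := q - (q - v) / a.
have p'u : p' < u by rewrite /p' -ltrBrDl ltr_pdivrMr ?subr_gt0// ltr_pMr ?subr_gt0.
have pp' : p < p' by rewrite ltrDl divr_gt0// subr_gt0.
have vq' : v < q'.
  by rewrite /q' ltrBrDl -ltrBrDr ltr_pdivrMr ?subr_gt0// ltr_pMr ?subr_gt0.
have q'q : q' < q by rewrite gtrBl divr_gt0// subr_gt0.
have [F2 [pl2 F2p' F2u]] := pl_interpolation p'u uv.
have [F3 [pl3 F3u F3v]] := pl_interpolation uv vq'.
have pl1 := @pl_affine_fun p p' p p 1 (ltW pp').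
have pl4 := @pl_affine_fun v q q' v (-1) (ltW vq).
have [|G [plG G1 G2]] := pl_glue pl1 pl2.
  by rewrite F2p' expr1z /p' addrAC subrr add0r mulrC divfK ?gt_eqF// addrC subrK.
have [|K [plK K1 K2]] := pl_glue plG pl3; first by rewrite G2 ?F2u ?F3u// ltW.
have [|F [plF FK F4]] := pl_glue plK pl4.
  by rewrite K2 ?F3v ?subrr ?mulr0 ?addr0// ltW.
have Fu : F u = v by rewrite FK ?K1 ?G2 ?F2u// ltW.
have Fp' : F p' = u.
  by rewrite FK ?K1 ?G2 ?F2p'// ltW// (lt_trans p'u).
have Fp t : p <= t -> t <= p' -> F t = p + a * (t - p).
  move=> _ tp'; have tu := le_trans tp' (ltW p'u).
  by rewrite FK ?(le_trans tu (ltW uv))// K1// G1// expr1z.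
have Fq t : v <= t -> t <= q -> F t = q - (q - t) / a.
  by move=> vt _; rewrite F4// -invr_expz expr1z /q'; ring.
exists F; split => // t /andP[pt tq].
have homo := pl_homo plF.
have [tp'|p't] := leP t p'.
  rewrite Fp ?(ltW pt)// -ltrBlDl ltr_pMl//; lra.
have [tu|ut] := leP t u.
  apply: le_lt_trans tu _; rewrite -Fp'; apply: homo => //; exact: ltW.
have [tv|vt] := leP t v.
  apply: le_lt_trans tv _; rewrite -Fu; apply: homo => //; exact: ltW.
have tq0 : 0 < q - t by rewrite subr_gt0.
by rewrite Fq ?ltW// ltrBrDl -ltrBrDr ltr_pdivrMr// ltr_pMr.
Qed.

End RealPiecewiseLinear.

(** * Elements of P^a from piecewise linear functions *)

Section UnitInterval.
Variable R : realType.
Implicit Types (f g : unit_interval R -> unit_interval R) (t : R).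

Lemma unit_interval_itv (x : unit_interval R) : 0 <= \val x <= 1.
Proof. by case: x => t /= /set_mem /=; rewrite in_itv. Qed.

Lemma mem_unit t : 0 <= t <= 1 -> t \in (`[0, 1]%classic : set R).
Proof. by move=> t01; apply: mem_set; rewrite /= in_itv. Qed.

Definition in_unit t (t01 : 0 <= t <= 1) : unit_interval R :=
  exist _ t (mem_unit t01).

(* The identity outside [0, 1]. *)
Definition ext f t : R := oapp (fun x : unit_interval R => \val (f x)) t (insub t).

Lemma extE f (x : unit_interval R) : ext f (\val x) = \val (f x).
Proof. by rewrite /ext valK. Qed.

Lemma ext_out f t : ~~ (0 <= t <= 1) -> ext f t = t.
Proof.
move=> nt; rewrite /ext insubF//; apply/negbTE; apply: contra nt.
by move/set_mem; rewrite /= in_itv.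
Qed.

Lemma ext_in f t (t01 : 0 <= t <= 1) : ext f t = \val (f (in_unit t01)).
Proof. exact: (extE f (in_unit t01)). Qed.

Lemma orientation_preserving_end f g : cancel g f -> orientation_preserving f ->
  ext f 0 = 0 /\ ext f 1 = 1.
Proof.
move=> gK fm; have fle := orientation_preserving_le fm.
have i0 : 0 <= (0 : R) <= 1 by rewrite lexx ler01.
have i1 : 0 <= (1 : R) <= 1 by rewrite lexx ler01.
split; apply/eqP; rewrite eq_le.
  have := unit_interval_itv (f (in_unit i0)); rewrite ext_in => /andP[-> _].
  rewrite andbT -[X in _ <= X]/(\val (in_unit i0)) -[X in _ <= \val X]gK fle.
  by case/andP: (unit_interval_itv (g (in_unit i0))).
have := unit_interval_itv (f (in_unit i1)); rewrite ext_in => /andP[_ ->].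
rewrite /= -[X in X <= _]/(\val (in_unit i1)) -[X in \val X <= _]gK fle.
by case/andP: (unit_interval_itv (g (in_unit i1))).
Qed.

(** An increasing surjection of a segment has no jumps. The topology is induced by the inclusion
    into the reals, which reduces the claim to [ext f] on [0, 1]. *)
Lemma orientation_preserving_continuous f g : cancel f g -> cancel g f ->
  orientation_preserving f -> continuous f.
Proof.
move=> fK gK fm; apply: (@continuous_comp_initial _ _ _ set_val).
have fle := orientation_preserving_le fm.
have [f0 f1] := orientation_preserving_end gK fm.
have inc : {in `[0, 1] &, {mono ext f : x y / x <= y}}.
  move=> s t; rewrite !in_itv /= => s01 t01; rewrite !ext_in.
  by rewrite (fle (in_unit s01) (in_unit t01)).
have surj : set_surj `[0, 1] `[ext f 0, ext f 1] (ext f).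
  rewrite f0 f1 => w; rewrite /= in_itv /= => w01.
  exists (\val (g (in_unit w01))); last by rewrite extE gK.
  by rewrite /= in_itv /=; exact: unit_interval_itv.
have /subspace_sigL_continuousP := segment_inc_surj_continuous inc surj.
suff -> : sigL `[0, 1]%classic (ext f) = set_val \o f by [].
by apply/funext => x /=; exact: extE.
Qed.

End UnitInterval.

Section Builder.
Variables (R : realType) (a : R).
Hypothesis a_gt1 : 1 < a.

Lemma seq_gap_right (s : seq R) (x y : R) : x < y ->
  exists y', [/\ x < y', y' <= y & forall z, z \in s -> ~~ (x < z < y')].
Proof.
move=> xy; elim: s => [|z s [y' [xy' y'y sy']]]; first by exists y; rewrite lexx.
have [/andP[xz zy']|nz] := boolP (x < z < y').
  exists z; split => //; first exact/ltW/(lt_le_trans zy').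
  move=> w; rewrite in_cons => /predU1P[->|/sy']; first by rewrite ltxx andbF.
  by apply: contra => /andP[-> wz]; exact: lt_trans zy'.
by exists y'; split => // w; rewrite in_cons => /predU1P[->//|]; exact: sy'.
Qed.

Lemma seq_gap_left (s : seq R) (x y : R) : x < y ->
  exists x', [/\ x <= x', x' < y & forall z, z \in s -> ~~ (x' < z < y)].
Proof.
rewrite -ltrN2 => /(seq_gap_right (map -%R s)) [x' [xx' x'y sx']].
exists (- x'); split; [by rewrite lerNr|by rewrite ltrNl|move=> z zs].
have /sx' : - z \in map -%R s by rewrite map_f.
by rewrite ltrN2 ltrNl andbC.
Qed.

Lemma Pa_of_pl (F : R -> R) : pl a F 0 1 -> F 0 = 0 -> F 1 = 1 ->
  exists g : Pa a, forall x, \val (g x) = F (\val x).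
Proof.
move=> Fpl F0 F1.
have homo := pl_homo a_gt1 Fpl.
have F01 t : 0 <= t <= 1 -> 0 <= F t <= 1.
  have mono u v : 0 <= u -> u <= v -> v <= 1 -> F u <= F v.
    rewrite (le_eqVlt u) => u0 /predU1P[->//|uv] v1.
    by rewrite ltW// homo.
  move=> /andP[t0 t1]; apply/andP.
  by split; [rewrite -[X in X <= _]F0|rewrite -[X in _ <= X]F1]; exact: mono.
pose f x : unit_interval R := in_unit (F01 _ (unit_interval_itv x)).
have fm : orientation_preserving f.
  move=> x y xy; apply: homo => //.
    by case/andP: (unit_interval_itv x).
  by case/andP: (unit_interval_itv y).
(* The inverse is chosen from surjectivity; continuity of both maps then comes from monotonicity. *)
have /boolp.choice [g gK] w : exists x, f x = w.
  have [|s s01 Fs] := pl_surj a_gt1 Fpl (w := \val w).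
    by rewrite F0 F1 unit_interval_itv.
  by exists (in_unit s01); apply: val_inj; rewrite /= Fs.
have fK : cancel f g.
  move=> x; apply: val_inj; apply/eqP.
  by rewrite eq_le -(orientation_preserving_le fm (g (f x)) x)
    -(orientation_preserving_le fm x) gK lexx.
have [s sP] := pl_breaks Fpl.
suff fP : Pa_map a f by exists (MkPa fP).
split => //.
- exists g; split => //; first exact: (orientation_preserving_continuous fK gK).
  apply: (orientation_preserving_continuous gK fK).
  exact: orientation_preserving_inv gK fm.
- exists (pmap insub s) => x y xy ns.
  have [||z zs|k Fk] := sP (\val x) (\val y) _ xy.
  + by case/andP: (unit_interval_itv x).
  + by case/andP: (unit_interval_itv y).
  + apply/negP => /andP[xz zy].
    have z01 : 0 <= z <= 1.
      have /andP[x0 _] := unit_interval_itv x.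
      have /andP[_ y1] := unit_interval_itv y.
      by rewrite (le_trans x0 (ltW xz)) (le_trans (ltW zy) y1).
    have /ns : in_unit z01 \in pmap insub s by rewrite mem_pmap_sub.
    by rewrite /= xz zy.
  + by exists (a ^ k) => t; exact: Fk.
- move=> c [x [y [xy fc]]].
  (* An interval on which [f] is affine may still contain points of [s]; the slope is read off on a
     smaller interval that avoids them. *)
  have [y' [xy' y'y ny']] := seq_gap_right s xy.
  have /andP[x0 _] := unit_interval_itv x.
  have /andP[_ y1] := unit_interval_itv y.
  have [k Fk] := sP _ _ x0 xy' (le_trans y'y y1) ny'.
  have y'01 : 0 <= y' <= 1 by rewrite (le_trans x0 (ltW xy')) (le_trans y'y y1).
  exists k; apply: (@affine_on_uniq R f x (in_unit y'01)).
  + exact: xy'.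
  + by apply: affine_on_sub fc => //; exact: ltW.
  + by move=> t; exact: Fk.
Qed.

End Builder.

(** * The action of P^a on the line, germs and bumps *)

Section Action.
Variables (R : realType) (a : R).
Hypothesis a_gt1 : 1 < a.
Implicit Types (f g h k : Pa a) (t x y p q c d e : R) (n : nat).

Let a_gt0 : 0 < a. Proof. exact: lt_trans a_gt1. Qed.

(** A left action on all real numbers: with the points outside [0, 1] fixed, monotonicity and
    inverses hold without side conditions. *)
Definition act g t := ext (Pa_fun g) t.

Lemma actM g h t : act (g * h)%g t = act g (act h t).
Proof.
have [t01|nt] := boolP (0 <= t <= 1); last by rewrite /act !ext_out ?ext_out.
by rewrite /act (ext_in _ t01) [ext h t](ext_in _ t01) extE.
Qed.

Lemma act_id t : act 1%g t = t.
Proof.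
have [t01|nt] := boolP (0 <= t <= 1); last by rewrite /act ext_out.
by rewrite /act (ext_in _ t01).
Qed.

Lemma actK g : cancel (act g) (act g^-1%g).
Proof. by move=> t; rewrite -actM mulVg act_id. Qed.

Lemma actVK g : cancel (act g^-1%g) (act g).
Proof. by move=> t; rewrite -actM mulgV act_id. Qed.

Lemma act_eq g h : act g =1 act h -> g = h.
Proof.
move=> gh; apply: Pa_eq => x; apply: val_inj.
by have := gh (\val x); rewrite /act !extE.
Qed.

Lemma act_ends g : act g 0 = 0 /\ act g 1 = 1.
Proof.
have [_ fm _ _] := Pa_funP g; apply: orientation_preserving_end fm.
move=> x; exact: (congr1 (fun f : Pa a => f x) (mulgV g)).
Qed.

Lemma act0 g : act g 0 = 0. Proof. by case: (act_ends g). Qed.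

Lemma act1 g : act g 1 = 1. Proof. by case: (act_ends g). Qed.

Lemma act_le g : {mono act g : x y / x <= y}.
Proof.
apply: le_mono => x y xy; have [_ fm _ _] := Pa_funP g.
have inr (t : R) (t01 : 0 <= t <= 1) : 0 <= act g t <= 1.
  by rewrite /act ext_in unit_interval_itv.
have [x01|nx] := boolP (0 <= x <= 1); have [y01|ny] := boolP (0 <= y <= 1).
- by rewrite /act !ext_in; exact: fm.
- rewrite /act (ext_out _ ny) -/(act g x); have := inr _ x01.
  by move: ny x01 xy; rewrite negb_and -!ltNge; lra.
- rewrite /act (ext_out _ nx) -/(act g y); have := inr _ y01.
  by move: nx y01 xy; rewrite negb_and -!ltNge; lra.
- by rewrite /act !ext_out.
Qed.

Lemma act_lt g : {mono act g : x y / x < y}.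
Proof. exact/leW_mono/act_le. Qed.

Lemma act_inj g : injective (act g).
Proof. exact: can_inj (actK g). Qed.

Lemma act_inside g t : 0 < t < 1 -> 0 < act g t < 1.
Proof. by rewrite -{2}(act0 g) -{2}(act1 g) !act_lt. Qed.

Lemma act_expS g n t : act (g ^+ n.+1)%g t = act g (act (g ^+ n)%g t).
Proof. by rewrite expgS actM. Qed.

Lemma act_exp_fix g n t : act g t = t -> act (g ^+ n)%g t = t.
Proof. by move=> gt; elim: n => [|n IH]; rewrite ?act_id// act_expS IH. Qed.

Lemma act_inv_fix g t : act g t = t -> act g^-1%g t = t.
Proof. by move=> gt; rewrite -{1}gt actK. Qed.

Lemma act_conj g k t : act (g ^ k)%g t = act k^-1%g (act g (act k t)).
Proof. by rewrite conjgE !actM. Qed.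

Lemma act_affine g : exists s : seq R, forall x y, 0 <= x -> x < y -> y <= 1 ->
  (forall z, z \in s -> ~~ (x < z < y)) ->
  exists k : int, forall t, x <= t <= y -> act g t = act g x + a ^ k * (t - x).
Proof.
have [_ fm [s sP] fsl] := Pa_funP g; exists (map \val s) => x y x0 xy y1 ns.
have x01 : 0 <= x <= 1 by rewrite x0 (le_trans (ltW xy)).
have y01 : 0 <= y <= 1 by rewrite y1 (le_trans x0 (ltW xy)).
have [//||c gc] := sP (in_unit x01) (in_unit y01).
  by move=> z zs; apply: ns; rewrite map_f.
have [|k ck] := fsl c; first by exists (in_unit x01), (in_unit y01).
exists k => t xty; have t01 : 0 <= t <= 1.
  by case/andP: xty => xt ty; rewrite (le_trans x0 xt) (le_trans ty y1).
by rewrite /act !ext_in (gc (in_unit t01))// ck.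
Qed.

(* [d] is 1 or -1, and [c] is the right or left slope of [g] at [x]. *)
Definition germ g d x c := exists2 e, 0 < e &
  forall t, 0 <= t <= e -> act g (x + d * t) = act g x + d * (c * t).

Lemma germ_exists g d x : d = 1 \/ d = -1 -> exists k : int, germ g d x (a ^ k).
Proof.
move=> dE.
(* A one-sided neighbourhood outside (0, 1) is fixed pointwise, so its slope is a^0. This includes
   the left side of 0 and the right side of 1. *)
have outside e : 0 < e ->
    (forall t, 0 <= t <= e -> x + d * t <= 0 \/ 1 <= x + d * t) ->
    exists k : int, germ g d x (a ^ k).
  move=> e0 out; exists 0; exists e => // t t0e; rewrite expr0z mul1r.
  have fixed u : u <= 0 \/ 1 <= u -> act g u = u.
    have [u01|nu] := boolP (0 <= u <= 1); last by rewrite /act ext_out.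
    case=> hu; first by have -> : u = 0 by [lra]; exact: act0.
    by have -> : u = 1 by [lra]; exact: act1.
  rewrite !fixed//; last exact: out.
  by have := out 0; rewrite mulr0 addr0; apply; rewrite lexx ltW.
have [s sP] := act_affine g; case: dE => ->{d} in outside *.
- have [x0|x0] := ltP x 0.
    by apply: (outside (- x)); [rewrite oppr_gt0|move=> t ht; left; lra].
  have [x1|x1] := ltP x 1; last first.
    by apply: (outside 1) => // t ht; right; lra.
  have [y [xy y1 sy]] := seq_gap_right s x1.
  have [k gk] := sP x y x0 xy y1 sy.
  exists k; exists (y - x); first by rewrite subr_gt0.
  by move=> t ht; rewrite gk; [ring|lra].
- have [x1|x1] := ltP 1 x.
    by apply: (outside (x - 1)); [rewrite subr_gt0|move=> t ht; right; lra].
  have [x0|x0] := ltP 0 x; last first.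
    by apply: (outside 1) => // t ht; left; lra.
  have [y [y0 yx sy]] := seq_gap_left s x0.
  have [k gk] := sP y x y0 yx x1 sy.
  exists k; exists (x - y); first by rewrite subr_gt0.
  by move=> t ht; rewrite (gk (x + -1 * t)) ?(gk x); [ring|lra|lra].
Qed.

Lemma germM g h d x c1 c2 : 0 < c2 -> germ g d (act h x) c1 -> germ h d x c2 ->
  germ (g * h)%g d x (c1 * c2).
Proof.
move=> c20 [e1 e10 g1] [e2 e20 h2].
(* [h] scales lengths by [c2], so a step of at most [e1 / c2] lands in the range of the germ of
   [g]. *)
exists (Num.min e2 (e1 / c2)); first by rewrite lt_min e20 divr_gt0.
move=> t /andP[t0]; rewrite le_min ler_pdivlMr// mulrC => /andP[te2 te1].
have c2t : 0 <= c2 * t <= e1 by rewrite te1 andbT mulr_ge0// ltW.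
by rewrite !actM h2 ?t0// g1// (mulrA c1).
Qed.

Lemma germV g d x c : 0 < c -> germ g d x c -> germ g^-1%g d (act g x) c^-1.
Proof.
move=> c0 [e e0 ge]; exists (e * c); first by rewrite mulr_gt0.
move=> t /andP[t0 te]; apply: (@act_inj g); rewrite actVK actK.
have ct : 0 <= c^-1 * t <= e.
  by rewrite ler_pdivrMl// [c * e]mulrC te andbT mulr_ge0// invr_ge0 ltW.
by rewrite ge// mulVKf ?gt_eqF.
Qed.

Lemma germ_id d x : germ 1%g d x 1.
Proof. by exists 1 => // t _; rewrite !act_id mul1r. Qed.

Lemma germX g d x c n : 0 < c -> act g x = x -> germ g d x c ->
  germ (g ^+ n)%g d x (c ^+ n).
Proof.
move=> c0 gx gc; elim: n => [|n IH]; first exact: germ_id.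
by rewrite expgS exprS; apply: germM; rewrite ?exprn_gt0 ?act_exp_fix.
Qed.

Lemma germ_agree g h d x c : germ g d x c -> germ h d x c -> act g x = act h x ->
  exists2 e, 0 < e & forall t, 0 <= t <= e -> act g (x + d * t) = act h (x + d * t).
Proof.
move=> [e1 e10 g1] [e2 e20 h2] gh.
exists (Num.min e1 e2); first by rewrite lt_min e10.
by move=> t /andP[t0]; rewrite le_min => /andP[t1 t2]; rewrite g1 ?h2 ?t0// gh.
Qed.

(** The end slopes are prescribed because conjugation preserves them and their integer powers
    exhaust the slopes allowed in P^a. *)
Record bump_on g p q : Prop := {
  bump_left : forall t, t <= p -> act g t = t;
  bump_right : forall t, q <= t -> act g t = t;
  bump_inside : forall t, p < t < q -> t < act g t;
  bump_germ_left : germ g 1 p a;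
  bump_germ_right : germ g (-1) q a^-1 }.

(** Since [g] fixes [x], the slopes of [k] at k^-1 x and of [k^-1] at [x] are inverse to each other,
    and slopes commute. *)
Lemma germ_conj g k d x c : d = 1 \/ d = -1 -> act g x = x -> 0 < c ->
  germ g d x c -> germ (g ^ k)%g d (act k^-1%g x) c.
Proof.
move=> dE gx c0 gc; have [j kj] := germ_exists k (act k^-1%g x) dE.
have j0 : 0 < a ^ j by exact: expz_gt0.
have kV : germ k^-1%g d x (a ^ j)^-1.
  by have := germV j0 kj; rewrite actVK.
rewrite conjgE -[c](mulKf (lt0r_neq0 j0)) [a ^ j * c]mulrC.
apply: germM; rewrite ?mulr_gt0//; first by rewrite actM actVK gx.
by apply: germM => //; rewrite actVK.
Qed.

Lemma bump_on_conj g k p q : bump_on g p q ->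
  bump_on (g ^ k)%g (act k^-1%g p) (act k^-1%g q).
Proof.
move=> [gp gq gi lp lq]; split.
- by move=> t; rewrite -(act_le k) actVK => kt; rewrite act_conj gp// actK.
- by move=> t; rewrite -(act_le k) actVK => kt; rewrite act_conj gq// actK.
- move=> t; rewrite -(act_lt k) -(act_lt k t) !actVK => kt.
  by rewrite act_conj -(act_lt k) actVK gi.
- by apply: germ_conj => //; [left|rewrite gp].
- by apply: germ_conj => //; [right|rewrite gq|rewrite invr_gt0].
Qed.

(** The explicit linear ranges serve for exact iteration: g^-1 divides the distance to [p] by [a] on
    [p, u], and [g] does so for the distance to [q] on [v, q]. *)
Lemma bump_exists p q u v : 0 <= p -> p < u -> u < v -> v < q -> q <= 1 ->
  exists g, [/\ bump_on g p q, act g u = v,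
    forall t, p <= t -> t <= p + (u - p) / a -> act g t = p + a * (t - p) &
    forall t, v <= t -> t <= q -> act g t = q - (q - t) / a].
Proof.
move=> p0 pu uv vq q1.
have [F [plF Fp Fu Fq Fi]] := pl_bump a_gt1 pu uv vq.
have pu' : p <= p + (u - p) / a.
  by rewrite lerDl ltW// divr_gt0// subr_gt0.
have Fpp : F p = p by rewrite Fp// subrr mulr0 addr0.
have Fqq : F q = q by rewrite Fq ?(ltW vq)// subrr mul0r subr0.
have [|K [plK Kp KF]] := pl_glue (pl_id a p0) plF; first by rewrite Fpp.
have pq : p < q by rewrite (lt_trans pu)// (lt_trans uv).
have [|G [plG GK Gq]] := pl_glue plK (pl_id a q1); first by rewrite KF ?Fqq// ltW.
have GF t : p <= t -> t <= q -> G t = F t by move=> pt tq; rewrite GK// KF.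
have Gp t : t <= p -> G t = t by move=> tp; rewrite GK ?Kp// (le_trans tp (ltW pq)).
have [||g gG] := Pa_of_pl a_gt1 plG; [exact: Gp|exact: Gq|].
have gE t : 0 <= t <= 1 -> act g t = G t by move=> t01; rewrite /act ext_in gG.
have gF t : p <= t -> t <= q -> act g t = F t.
  by move=> pt tq; rewrite gE ?GF// (le_trans p0 pt) (le_trans tq q1).
have gl t : p <= t -> t <= p + (u - p) / a -> act g t = p + a * (t - p).
  move=> pt tu; rewrite gF ?Fp//.
  apply: le_trans tu (ltW (le_lt_trans _ (lt_trans uv vq))).
  by rewrite -lerBrDl ler_pdivrMr// ler_peMr ?(ltW a_gt1)// subr_ge0 ltW.
have gr t : v <= t -> t <= q -> act g t = q - (q - t) / a.
  by move=> vt tq; rewrite gF ?Fq// ltW// (lt_le_trans _ vt)// (lt_trans pu).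
exists g; split => //; last by rewrite gF// ltW// (lt_trans uv).
split.
- move=> t tp; have [t01|nt] := boolP (0 <= t <= 1); last by rewrite /act ext_out.
  by rewrite gE// Gp.
- move=> t tq; have [t01|nt] := boolP (0 <= t <= 1); last by rewrite /act ext_out.
  by rewrite gE// Gq.
- by move=> t /andP[pt tq]; rewrite gF ?ltW ?Fi ?pt.
- exists ((u - p) / a); first by rewrite divr_gt0// subr_gt0.
  move=> t /andP[t0 tu]; rewrite !gl ?lexx// ?mul1r ?lerDl ?lerD2l//.
  by ring.
- exists (q - v); first by rewrite subr_gt0.
  by move=> t ht; rewrite !gr//; [ring|lra|lra|lra].
Qed.

(* The supremum of a bounded forward orbit would be a fixed point. *)
Lemma orbit_escapes g p q x y : (forall t, p < t < q -> t < act g t) ->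
  p < x < q -> p < y < q -> exists n, y < act (g ^+ n)%g x.
Proof.
move=> gi /andP[px xq] /andP[py yq]; apply/not_existsP => nesc.
have bd n : act (g ^+ n)%g x <= y by rewrite leNgt; apply/negP/nesc.
pose E : set R := range (fun n => act (g ^+ n)%g x).
have supE : has_sup E.
  split; first by exists x; exists 0%N => //; rewrite expg0 act_id.
  by exists y => _ [n _ <-].
have xs : x <= sup E.
  by apply: sup_upper_bound => //; exists 0%N => //; rewrite expg0 act_id.
have sy : sup E <= y by apply: ge_sup; [case: supE|move=> _ [n _ <-]].
(* Some orbit point lies above g^-1 (sup E), and the next one then exceeds sup E. *)
have : act g^-1%g (sup E) < sup E.
  by rewrite -(act_lt g) actVK gi// (lt_le_trans px)// (le_lt_trans sy).
rewrite -subr_gt0 => /sup_adherent -/(_ _ supE)[_ [n _ <-]].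
rewrite subKr -(act_lt g) actVK -act_expS ltNge => /negP; apply.
by apply: sup_upper_bound => //; exists n.+1.
Qed.

End Action.

(** * Classful subgroups *)

Section Classful.
Variables (R : realType) (a : R).
Hypothesis a_gt1 : 1 < a.
Implicit Types (f g h k r : Pa a) (t x y p q c d e u v : R) (n m : nat).

Let a_gt0 : 0 < a. Proof. exact: lt_trans a_gt1. Qed.

Lemma act_expVK g n : cancel (act (g^-1 ^+ n)%g) (act (g ^+ n)%g).
Proof. by move=> t; rewrite -actM expVgn mulgV act_id. Qed.

(** As in [germ], [d] selects the side of [z]; taking t = 0 shows that [f] fixes [z]. The uses are z
    = 0 with d = 1 and z = 1 with d = -1. *)
Definition contracting f z d tau :=
  forall t, 0 <= t <= tau -> act f (z + d * t) = z + d * (t / a).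

Lemma contracting_exp f z d tau n : 0 <= tau -> contracting f z d tau ->
  act (f ^+ n)%g (z + d * tau) = z + d * (tau / a ^+ n).
Proof.
move=> tau0 fc; elim: n => [|n IH]; first by rewrite act_id expr0 divr1.
rewrite act_expS IH fc; first by rewrite -[_ / a]mulrA -invfM -exprSr.
rewrite divr_ge0 ?exprn_ge0 ?(ltW a_gt0)//= ler_pdivrMr ?exprn_gt0//.
by rewrite ler_peMr// exprn_ege1// ltW.
Qed.

(* The germ of [k] at the fixed point [z] has slope a power of [a], which iterating
   [f1] compensates. *)
Lemma contracting_match f1 f2 k z d tau : d = 1 \/ d = -1 -> act k z = z ->
  0 <= tau -> contracting f1 z d tau -> contracting f2 z d tau ->
  exists m n, act (f1 ^+ m)%g (z + d * tau) = act k (act (f2 ^+ n)%g (z + d * tau)).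
Proof.
move=> dE kz tau0 fc1 fc2.
have [j [e e0 kj]] := germ_exists k z dE.
(* [N] iterations bring the point into the range [e] where [k] is linear; the additional |j| make n
   - j a natural number. *)
have [N hN] := exists_expn_gt a_gt1 (tau / e).
pose n := (N + `|j|)%N; pose m := `|n%:Z - j|%N.
have mE : m%:Z = n%:Z - j.
  rewrite /m gez0_abs// subr_ge0 PoszD abszE.
  by apply: le_trans (ler_norm j) _; rewrite lerDr.
have an0 i : 0 < a ^+ i by rewrite exprn_gt0.
exists m, n; rewrite !contracting_exp// kj ?kz.
  have -> : a ^+ m = a ^+ n / a ^ j.
    by rewrite -[a ^+ m]/(a ^ m%:Z) mE expfzDr ?lt0r_neq0// -invr_expz.
  by congr (_ + _ * _); rewrite invf_div mulrCA.
rewrite divr_ge0 ?(ltW (an0 _))//= ler_pdivrMr// mulrC -ler_pdivrMr//.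
by apply: le_trans (ltW hN) _; rewrite ler_weXn2l ?(ltW a_gt1)// leq_addr.
Qed.

Lemma germ_of_fixed g d x : (forall t, 0 <= t -> act g (x + d * t) = x + d * t) ->
  germ g d x 1.
Proof.
move=> gx; exists 1 => // t /andP[t0 _]; rewrite mul1r gx//.
by have := gx 0 (lexx _); rewrite mulr0 addr0 => ->.
Qed.

Variable H : Pa a -> Prop.
Hypothesis H1 : H 1%g.
Hypothesis HM : forall g h, H g -> H h -> H (g * h)%g.
Hypothesis HV : forall g, H g -> H g^-1%g.
Hypothesis H_classful : forall g, exists k, H (g ^ k)%g.

Lemma HX g n : H g -> H (g ^+ n)%g.
Proof. by move=> Hg; elim: n => // n IH; rewrite expgS; exact: HM. Qed.

Lemma HJ g k : H g -> H k -> H (g ^ k)%g.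
Proof. by move=> Hg Hk; rewrite conjgE; apply: HM; [exact: HV|exact: HM]. Qed.

(** The witness is f^j. The clause on fixed points keeps the germ on the other side of [x] trivial
    when [f] is a bump ending at [x]. *)
Lemma germ_expz f d x c (j : int) : H f -> 0 < c -> act f x = x -> germ f d x c ->
  exists r, [/\ H r, forall t, act f t = t -> act r t = t & germ r d x (c ^ j)].
Proof.
move=> Hf c0 fx fc; case: j => n.
  exists (f ^+ n)%g; split; [exact: HX|move=> t; exact: act_exp_fix|exact: germX].
exists (f^-1 ^+ n.+1)%g; split; first exact/HX/HV.
  by move=> t ft; apply/act_exp_fix/act_inv_fix.
rewrite NegzE -exprz_inv; apply: germX; rewrite ?invr_gt0//; first exact: act_inv_fix.
by rewrite -{1}fx; exact: germV.
Qed.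

(** * Transitivity of [H] on (0, 1) *)

Definition reach x y := exists2 h, H h & act h x = y.

Lemma reach_trans y x z : reach x y -> reach y z -> reach x z.
Proof.
move=> [h Hh <-] [h' Hh' <-]; exists (h' * h)%g; first exact: HM.
by rewrite actM.
Qed.

Lemma reach_sym x y : reach x y -> reach y x.
Proof. by move=> [h Hh <-]; exists h^-1%g; [exact: HV|rewrite actK]. Qed.

Lemma reach_exp h n x : H h -> reach x (act (h ^+ n)%g x).
Proof. by move=> Hh; exists (h ^+ n)%g => //; exact: HX. Qed.

Lemma H_transitive x y : 0 < x < 1 -> 0 < y < 1 -> reach x y.
Proof.
move=> x01 y01.
have [b [bb _ _ _]] : exists g : Pa a, [/\ bump_on g 0 1, act g (1 / 3) = 2 / 3,
    forall t, 0 <= t -> t <= 0 + (1 / 3 - 0) / a -> act g t = 0 + a * (t - 0) &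
    forall t, 2 / 3 <= t -> t <= 1 -> act g t = 1 - (1 - t) / a].
  by apply: bump_exists; rewrite //; lra.
have [k0 Hh0] := H_classful b; have {bb} := bump_on_conj a_gt1 k0 bb.
rewrite act0 act1; set h0 := (b ^ k0)%g in Hh0 *.
move=> [_ _ h0i [e0 e00 h0l] [e1 e10 h0r]].
(* [h0] has slope [a] on [0, c0] and 1/a on [v0, 1]; the cut-offs 1/3 and 2/3 ensure c < v below. *)
pose c0 := Num.min e0 (1 / 3); pose v0 := Num.max (1 - e1) (2 / 3).
have c0P : 0 < c0 <= e0 by rewrite /c0 lt_min e00 ge_min lexx//=; lra.
have c0lt : c0 <= 1 / 3 by rewrite ge_min lexx orbT.
have v0P : 1 - e1 <= v0 < 1.
  by rewrite /v0 le_max lexx gt_max /=; apply/andP; split; lra.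
have v0gt : 2 / 3 <= v0 by rewrite le_max lexx orbT.
have c001 : 0 < c0 < 1 by lra.
have v001 : 0 < v0 < 1 by lra.
have [N xN] := orbit_escapes h0i c001 x01.
have [M yM] := orbit_escapes h0i y01 v001.
pose c := act (h0^-1 ^+ N)%g x; pose v := act (h0 ^+ M)%g y.
have cc0 : c < c0 by rewrite -(act_lt (h0 ^+ N)%g) act_expVK.
have v0v : v0 < v by [].
have /andP[c_gt0 _] : 0 < c < 1 := act_inside _ x01.
have /andP[_ v_lt1] : 0 < v < 1 := act_inside _ y01.
have [g [_ gc gl gr]] : exists g : Pa a, [/\ bump_on g 0 1, act g c = v,
    forall t, 0 <= t -> t <= 0 + (c - 0) / a -> act g t = 0 + a * (t - 0) &
    forall t, v <= t -> t <= 1 -> act g t = 1 - (1 - t) / a].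
  by apply: bump_exists; rewrite //; lra.
have [k Hgk] := H_classful g.
have ta t : 0 <= t -> 0 <= t / a <= t.
  by move=> t0; rewrite divr_ge0 ?(ltW a_gt0)//= ler_pdivrMr// ler_peMr// ltW.
(* The inverses of [h0] and [g] both contract [0, c] towards 0; for the second match, [h0] and [g]
   both contract [v, 1] towards 1. *)
have [m [n mn]] : exists m n, act (h0^-1 ^+ m)%g (0 + 1 * c) =
    act k^-1%g (act (g^-1 ^+ n)%g (0 + 1 * c)).
  apply: contracting_match; rewrite ?act0//; [by left|exact: ltW| |] => t /andP[t0 tc].
    apply: (@act_inj _ _ h0); have /andP[ta0 ta1] := ta _ t0.
    by rewrite actVK h0l ?act0 ?ta0 /=; [field; exact: lt0r_neq0|lra].
  apply: (@act_inj _ _ g); have /andP[ta0 ta1] := ta _ t0.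
  rewrite actVK mul1r !add0r mul1r gl ?subr0 ?add0r//.
    by rewrite mulrC divfK// lt0r_neq0.
  by rewrite ler_pM2r// invr_gt0.
have [m' [n' mn']] : exists m n, act (h0 ^+ m)%g (1 + -1 * (1 - v)) =
    act k^-1%g (act (g ^+ n)%g (1 + -1 * (1 - v))).
  apply: contracting_match; rewrite ?act1//; [by right|lra| |] => t /andP[t0 tc].
    by rewrite h0r ?act1; [rewrite [a^-1 * t]mulrC|lra].
  by rewrite gr; [ring|lra|lra].
rewrite mul1r add0r in mn.
have vE : 1 + -1 * (1 - v) = v by ring.
rewrite vE in mn'.
(* The path is x, c, h0^-m c = k^-1 g^-n c, k^-1 g^n' v = h0^m' v, v, y. All moves but the middle
   one are powers of [h0]. *)
apply: (reach_trans (y := c)); first exact/reach_exp/HV.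
apply: (reach_trans (y := act (h0^-1 ^+ m)%g c)); first exact/reach_exp/HV.
apply: (reach_trans (y := v)); last exact/reach_sym/reach_exp.
apply: (reach_trans (y := act (h0 ^+ m')%g v)); last exact/reach_sym/reach_exp.
(* Of the exponent, [n] undoes g^-n, one more step takes [c] to [v], and [n'] remain. *)
rewrite mn mn'; exists ((g ^ k) ^+ (n' + n.+1))%g; first exact: HX.
by rewrite -conjXg act_conj actVK expgnDr actM expgS [act (g * _)%g _]actM act_expVK gc.
Qed.

(** * Local matches and their extension to compact intervals *)

Lemma H_bump_left y : 0 < y < 1 -> exists2 f, H f & bump_on f 0 y.
Proof.
move=> y01.
have [b [bb _ _ _]] : exists g : Pa a, [/\ bump_on g 0 (1 / 2), act g (1 / 6) = 1 / 3,
    forall t, 0 <= t -> t <= 0 + (1 / 6 - 0) / a -> act g t = 0 + a * (t - 0) &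
    forall t, 1 / 3 <= t -> t <= 1 / 2 -> act g t = 1 / 2 - (1 / 2 - t) / a].
  by apply: bump_exists; rewrite //; lra.
have [k Hbk] := H_classful b.
have [||r Hr ry] := @H_transitive y (act k^-1%g (1 / 2)) => //.
  (* The conjugate of [b] in [H] ends at k^-1 (1/2); conjugating further by [r], which sends [y]
     there, stays in [H] and moves the end to [y]. *)
  by apply: act_inside; lra.
exists ((b ^ k) ^ r)%g; first exact: HJ.
have := bump_on_conj a_gt1 r (bump_on_conj a_gt1 k bb).
by rewrite !act0 -ry actK.
Qed.

Lemma H_bump_right y : 0 < y < 1 -> exists2 f, H f & bump_on f y 1.
Proof.
move=> y01.
have [b [bb _ _ _]] : exists g : Pa a, [/\ bump_on g (1 / 2) 1, act g (2 / 3) = 3 / 4,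
    forall t, 1 / 2 <= t -> t <= 1 / 2 + (2 / 3 - 1 / 2) / a ->
      act g t = 1 / 2 + a * (t - 1 / 2) &
    forall t, 3 / 4 <= t -> t <= 1 -> act g t = 1 - (1 - t) / a].
  by apply: bump_exists; rewrite //; lra.
have [k Hbk] := H_classful b.
have [||r Hr ry] := @H_transitive y (act k^-1%g (1 / 2)) => //.
  by apply: act_inside; lra.
exists ((b ^ k) ^ r)%g; first exact: HJ.
have := bump_on_conj a_gt1 r (bump_on_conj a_gt1 k bb).
by rewrite !act1 -ry actK.
Qed.

(** A bump on (x, 1) adjusts the right slope and one on (0, x) the left slope; each is the identity
    on the other side, so the two choices are independent. *)
Lemma H_germs x (i j : int) : 0 < x < 1 -> exists r,
  [/\ H r, act r x = x, germ r 1 x (a ^ i) & germ r (-1) x (a ^ j)].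
Proof.
move=> x01.
have [f Hf [fl fr _ fg _]] := H_bump_right x01.
have [f' Hf' [fl' fr' _ _ fg']] := H_bump_left x01.
have fx : act f x = x by exact: fl.
have fx' : act f' x = x by exact: fr'.
have [r [Hr rf rg]] := germ_expz i Hf a_gt0 fx fg.
have aV0 : 0 < a^-1 by rewrite invr_gt0.
(* The left slope at the right end of a bump is 1/a, hence the exponent -j. *)
have [r' [Hr' rf' rg']] := germ_expz (- j) Hf' aV0 fx' fg'.
rewrite exprz_inv opprK in rg'.
have rx : act r x = x by exact: rf.
have rx' : act r' x = x by exact: rf'.
exists (r * r')%g; split; [exact: HM|by rewrite actM rx' rx| |].
- rewrite -[a ^ i]mulr1; apply: germM; rewrite ?rx'//.
  by apply: germ_of_fixed => t t0; apply/rf'/fr'; rewrite lerDl mul1r.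
- rewrite -[a ^ j]mul1r; apply: germM; rewrite ?rx' ?expz_gt0//.
  by apply: germ_of_fixed => t t0; apply/rf/fl; rewrite gerDl mulN1r oppr_le0.
Qed.

(** Transitivity gives [h0] in [H] with h0 x = k x; then h0^-1 k fixes [x], and its two germs there
    are realized in [H]. *)
Lemma H_match_near k x : 0 < x < 1 -> exists h e,
  [/\ H h, 0 < e & forall t, x - e <= t <= x + e -> act h t = act k t].
Proof.
move=> x01; have [h0 Hh0 h0x] := H_transitive x01 (act_inside k x01).
pose g := (h0^-1 * k)%g.
have gx : act g x = x by rewrite actM -h0x actK.
have [i gi] := germ_exists g x (or_introl erefl).
have [j gj] := germ_exists g x (or_intror erefl).
have [r [Hr rx ri rj]] := H_germs i j x01.
have rgx : act r x = act g x by rewrite rx.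
have [e1 e10 rg1] := germ_agree ri gi rgx.
have [e2 e20 rg2] := germ_agree rj gj rgx.
exists (h0 * r)%g, (Num.min e1 e2); split; [exact: HM|by rewrite lt_min e10|].
have m1 : Num.min e1 e2 <= e1 by rewrite ge_min lexx.
have m2 : Num.min e1 e2 <= e2 by rewrite ge_min lexx orbT.
move=> t ht; rewrite actM; apply: (can_inj (actK h0^-1%g)); rewrite actK -actM -/g.
have [xt|tx] := leP x t.
  have -> : t = x + 1 * (t - x) by ring.
  by apply: rg1; lra.
have -> : t = x + -1 * (x - t) by ring.
by apply: rg2; lra.
Qed.

(* Conjugating [h2^-1 * h1], which is the identity on [w, y], by powers of a
   bump on [0, y] makes it the identity on [u, y] without changing it beyond
   [y]. *)
Lemma H_glue h1 h2 u w y : H h1 -> H h2 -> 0 < u < y -> 0 < w < y -> y < 1 ->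
  (forall t, w <= t <= y -> act h1 t = act h2 t) ->
  exists h, [/\ H h, forall t, u <= t <= y -> act h t = act h1 t &
                forall t, y <= t -> act h t = act h2 t].
Proof.
move=> Hh1 Hh2 uy wy y1 h12; have y01 : 0 < y < 1 by lra.
have [f Hf [_ fr fi _ _]] := H_bump_left y01.
have [n wn] := orbit_escapes fi uy wy.
set F := (f ^+ n)%g in wn.
have HF : H F by exact: HX.
have Fr t : y <= t -> act F t = t by move=> yt; apply/act_exp_fix/fr.
pose d := (h2^-1 * h1)%g.
have Hd : H d by apply: HM => //; exact: HV.
(* On [u, y], [F] lands in [w, y], where [d] is the identity, which leaves [h1]. Beyond [y], [F] is
   the identity, which leaves h1 d^-1 = h2. *)
exists (h1 * (d ^ F)^-1)%g; split; first by apply/HM/HV/HJ.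
- move=> t /andP[ut ty]; rewrite actM; congr act; apply: act_inv_fix.
  have Ft : w <= act F t <= y.
    by rewrite -{1}(Fr y)// act_le ty andbT (le_trans (ltW wn))// act_le.
  by rewrite act_conj actM h12// actK actK.
- move=> t yt; rewrite actM; apply: (can_inj (actK h1^-1%g)); rewrite actK.
  apply: (can_inj (actK (d ^ F)%g)); rewrite actVK act_conj.
  have h12y : act h1 y = act h2 y by apply: h12; rewrite lexx andbT; lra.
  have ys : y <= act h1^-1%g (act h2 t) by rewrite -(act_le h1) actVK h12y act_le.
  by rewrite (Fr _ ys) actM actVK actK act_inv_fix// Fr.
Qed.

(** A continuation argument: if matches could not be extended up to [v], gluing a match on [u, y],
    with [y] close to sup E, to a local match around sup E would go past sup E. *)
Lemma H_match k u v : 0 < u -> u <= v -> v < 1 ->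
  exists2 h, H h & forall t, u <= t <= v -> act h t = act k t.
Proof.
move=> u0 uv v1.
pose E : set R := [set y : R | u <= y <= v /\
  exists2 h, H h & forall t, u <= t <= y -> act h t = act k t]%classic.
have Eu : E u.
  split; first by rewrite lexx.
  have [|h [e [Hh e0 hk]]] := @H_match_near k u; first by lra.
  by exists h => // t ht; apply: hk; lra.
have supE : has_sup E.
  by split; [exists u|exists v => y [/andP[_]]].
have us : u <= sup E by apply: sup_upper_bound.
have sv : sup E <= v by apply: ge_sup; [case: supE|move=> y [/andP[_]]].
have [|hs [e [Hhs e0 hsk]]] := @H_match_near k (sup E); first by lra.
have [y [/andP[uy yv] [h Hh hk]] ey] := sup_adherent e0 supE.
have ys : y <= sup E by apply: sup_upper_bound => //; split; [rewrite uy|exists h].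
pose z := Num.min (sup E + e) v.
have zs : z <= sup E + e by rewrite ge_min lexx.
have zv : z <= v by rewrite ge_min lexx orbT.
have Ez : E z.
  split; first by rewrite zv andbT le_min uv andbT; lra.
  (* When y = u there is nothing to glue: [u, z] lies in the range of [hs]. *)
  have [yu|{}uy] := leP y u; first by exists hs => // t ht; apply: hsk; lra.
  (* Both matches hold on the overlap [w, y]. *)
  pose w := Num.max u (sup E - e).
  have uw : u <= w by rewrite le_max lexx.
  have ew : sup E - e <= w by rewrite le_max lexx orbT.
  have wy : w < y by rewrite gt_max uy.
  have [||||h' [Hh' h'h h'hs]] := @H_glue h hs u w y Hh Hhs.
  - by lra.
  - by lra.
  - by lra.
  - by move=> t ht; rewrite hk ?hsk//; lra.
  exists h' => // t ht; have [ty|yt] := leP t y.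
    by rewrite h'h ?hk//; lra.
  by rewrite h'hs ?hsk//; lra.
have : z <= sup E by apply: sup_upper_bound.
rewrite ge_min => /orP[|vs]; first by lra.
have vz : z = v by rewrite /z min_r//; lra.
by case: Ez => _; rewrite vz.
Qed.

(** * From compact supports to the whole group *)

Lemma H_compact_support g e : 0 < e < 1 / 2 ->
  (forall t, t <= e -> act g t = t) -> (forall t, 1 - e <= t -> act g t = t) -> H g.
Proof.
move=> e01 gl gr; have [k Hgk] := H_classful g.
pose u := act k^-1%g e; pose v := act k^-1%g (1 - e).
have /andP[u0 _] : 0 < u < 1 by apply: act_inside; lra.
have /andP[_ v1] : 0 < v < 1 by apply: act_inside; lra.
have uv : u <= v by rewrite act_le; lra.
have [h Hh hk] := H_match k u0 uv v1.
(* The support of [g ^ k] lies in [u, v], where [h] equals [k], so conjugating back by [h] has the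
   effect of conjugating back by [k]. *)
suff -> : g = ((g ^ k) ^ h^-1)%g by apply/HJ/HV.
apply: act_eq => t; rewrite act_conj invgK act_conj.
have hE s : e <= s <= 1 - e -> act h (act k^-1%g s) = s.
  by move=> hs; rewrite hk ?actVK// !act_le.
have hV s : e <= s <= 1 - e -> act h^-1%g s = act k^-1%g s.
  by move=> hs; rewrite -{1}(hE _ hs) actK.
(* Outside [e, 1 - e] the values of [h] are not controlled, but monotonicity keeps k h^-1 t on the
   same side, where [g] is the identity. *)
have [te|et] := ltP t e.
  have ke : act k (act h^-1%g t) <= e.
    have eI : e <= e <= 1 - e by lra.
    by rewrite -(act_le k^-1%g) actK -hV// act_le ltW.
  by rewrite (gl _ ke) actK actVK gl// ltW.
have [te|{}te] := ltP (1 - e) t.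
  have ke : 1 - e <= act k (act h^-1%g t).
    have eI : e <= 1 - e <= 1 - e by lra.
    by rewrite -(act_le k^-1%g) actK -hV// act_le ltW.
  by rewrite (gr _ ke) actK actVK gr// ltW.
rewrite hV ?et// actVK hE//.
by rewrite -{1}(gl e (lexx _)) -(gr (1 - e) (lexx _)) !act_le et.
Qed.

Lemma H_full g : H g.
Proof.
have [k Hgk] := H_classful g.
pose c := (g * (g ^ k)^-1)%g.
suff Hc : H c by rewrite -[g]mulg1 -(mulVg (g ^ k)%g) mulgA -/c; exact: HM.
(* At a common fixed point, [g] and its conjugate have the same slope, so [c] has slope 1 and is the
   identity near both end points. *)
have germ_c d x : d = 1 \/ d = -1 -> (forall f, act f x = x) -> germ c d x 1.
  move=> dE fix_x; have [j gj] := germ_exists g x dE.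
  have j0 := expz_gt0 a_gt1 j.
  have := germ_conj a_gt1 k dE (fix_x g) j0 gj; rewrite fix_x => /(germV j0).
  rewrite fix_x => gkj; rewrite -(mulfV (lt0r_neq0 j0)).
  by apply: germM => //; rewrite ?invr_gt0// fix_x.
have [e0 e00 c0] := germ_c 1 0 (or_introl erefl) (@act0 _ a).
have [e1 e10 c1] := germ_c (-1) 1 (or_intror erefl) (@act1 _ a).
pose e := Num.min (1 / 3) (Num.min e0 e1).
have e_lt : e <= 1 / 3 by rewrite ge_min lexx.
have e_e0 : e <= e0 by rewrite /e !ge_min lexx !orbT.
have e_e1 : e <= e1 by rewrite /e !ge_min lexx !orbT.
have e_gt0 : 0 < e by rewrite !lt_min e00 e10 !andbT; lra.
have outside t : t < 0 \/ 1 < t -> act c t = t.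
  by move=> ht; apply: ext_out; apply/negP; lra.
apply: (@H_compact_support c e); first by lra.
- move=> t te; have [t0|t0] := ltP t 0; first by apply: outside; left.
  by have := c0 t; rewrite act0 !mul1r !add0r; apply; lra.
- move=> t te; have [t1|t1] := ltP 1 t; first by apply: outside; right.
  have := c1 (1 - t); rewrite act1 mul1r.
  have -> : 1 + -1 * (1 - t) = t by ring.
  by apply; lra.
Qed.

End Classful.

Theorem theorem2 (R : realType) (a : R) (ha : 1 < a) :
  invariably_generated (Pa a).
Proof.
move=> H [H1 HD] Hcl.
(* [group_closed] gives the unit and closure under g h^-1; inverses are 1 g^-1, and products are g
   (h^-1)^-1. *)
have HV g : H g -> H g^-1%g.
  by move=> /mem_set Hg; apply/set_mem; rewrite -[g^-1%g]mul1g; exact: HD.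
have HM g h : H g -> H h -> H (g * h)%g.
  move=> /mem_set Hg /HV/mem_set Hh; apply/set_mem.
  by rewrite -[h]invgK; exact: HD.
apply/seteqP; split => // g _; apply: (H_full ha) => //.
- exact: set_mem.
- by move=> f; have [_ [k ->] Hk] := Hcl f; exists k.
Qed.
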